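(* Let $U=(U_{ij})_{i,j\in I}$ be a nonsingular $\mathcal U$-matrix with supporting dyadic tree $(T,\mathcal J)$, root $r$ (identified with $I$) and distinguished leaf $n$. Then: (i) $\mathcal R^t_I=\{n\}$. (ii) For every vertex $L\in T$ and every leaf $i\in L$: $i\in\mathcal R^t_L$ if and only if $\mathrm{geod}(i,L)\cap\Gamma^t=\emptyset$ (where $\mathrm{geod}(i,L)$ is regarded as a set of edges).
   Context: Trees. $(T,\mathcal J)$ is a finite tree with a distinguished root $r$; $\mathrm{geod}(s,t)$ is the unique shortest path between vertices $s,t$ (also regarded as its set of edges). Write $s\preceq t$ if $s$ lies on $\mathrm{geod}(t,r)$ (so $r$ is the least element). $s\wedge t$ is the $\preceq$-largest vertex lying on both $\mathrm{geod}(s,r)$ and $\mathrm{geod}(t,r)$. The successors of $t$ are its neighbours $s\ne t$ with $t\preceq s$; leaves are vertices without successors and their set is $I$. The tree is dyadic if every non-leaf $t$ has exactly two successors, denoted $t^-$ and $t^+$. Each vertex $t$ is identified with the set of leaves $i$ with $t\preceq i$ (so $r$ is identified with $I$, a leaf $i$ with $\{i\}$, and ''$i\in L$'' for a vertex $L$ means $i$ is a leaf below $L$). Edges are written $(L,L^-)$ and $(L,L^+)$. $\mathcal U$-matrices. A real matrix $U=(U_{ij})_{i,j\in I}$ is a $\mathcal U$-matrix if there exist a dyadic tree with root $r$ and leaf set $I$, a distinguished leaf $n$, and nonnegative vectors $(\alpha_t)_{t\in T},(\beta_t)_{t\in T}$ such that: (i) $\alpha_i=\beta_i$ for every leaf $i$,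 and $\alpha_t=\alpha_{t\wedge n}$ for every non-leaf $t$ with $r^+\preceq t$; (ii) $\alpha_t\le\beta_t$ for all $t$; (iii) $t\preceq s$ implies $\alpha_t\le\alpha_s$ and $\beta_t\le\beta_s$; (iv) for every non-leaf $t$ on $\mathrm{geod}(r,n)$, $t^+$ lies on $\mathrm{geod}(r,n)$, and $\alpha_t=\beta_t$ for all $t$ on $\mathrm{geod}(r,n)$; (v) $U_{ii}=\alpha_i$, and for $i\neq j$ with $t=i\wedge j$: $U_{ij}=\alpha_t$ if $i\in t^-,j\in t^+$, while $U_{ij}=\beta_s$ if $i\in t^+,j\in t^-$, where $s$ is the $\preceq$-larger of $i\wedge j$ and $i\wedge n$. The leaves are labelled $I=\{1,\dots,n\}$ so that $i<j$ iff $i\in(i\wedge j)^-$ and $j\in(i\wedge j)^+$; the distinguished leaf is the label $n$. Potentials and exiting roots. For a vertex $L$ let $U_L=U|_{L\times L}$ (nonsingular whenever $U$ is). Put $\nu_L=(U_L^t)^{-1}\mathbf 1$ and $\mathcal R^t_L=\{i\in L:(\nu_L)_i>0\}$ (exiting roots of the transposed sub-Markov kernel). The set $\Gamma^t$ of edges. For a leaf $i$ let $N_i^+=\{L\in T: L\preceq i,\ \alpha_L=\alpha_i\}$ and $N_i^-=\{L\in T:L\preceq i,\ \beta_L=\beta_i\}$. For a non-leaf $L$ not on $\mathrm{geod}(r,n)$: $(L,L^-)\in\Gamma^t$ iff there is $i\in L^+$ with $L\in N_i^-$; $(L,L^+)\in\Gamma^t$ iff there is $i\in L^-$ with $L\in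 N_i^+$. For a non-leaf $L$ on $\mathrm{geod}(r,n)$: $(L,L^-)\in\Gamma^t$ and $(L,L^+)\notin\Gamma^t$. *)

(* Defs.v *)
From HB Require Import structures.
From mathcomp Require Import all_boot all_order all_algebra.
Set Implicit Arguments.
Unset Strict Implicit.
Unset Printing Implicit Defensive.
Import Order.TTheory GRing.Theory Num.Theory.
Local Open Scope ring_scope.

Section RootedTrees.
Variable T : finType.

Definition simple_path (e : rel T) (s t : T) (p : seq T) : bool :=
  [&& path e s p, last s p == t & uniq (s :: p)].

(* A tree is a simple graph in which any two vertices are joined by exactly
   one simple path. *)
Record rooted_tree := RootedTree {
  adj : rel T;
  tree_root : T;
  adj_sym : symmetric adj;
  adj_irr : irreflexive adj;
  simple_path_ex : forall s t, exists p, simple_path adj s t p;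
  simple_path_uniq : forall s t p q,
    simple_path adj s t p -> simple_path adj s t q -> p = q
}.

Variable G : rooted_tree.

(* The vertices of the geodesic, both ends included: as it is the only simple
   path from s to t, it is also the only shortest one. *)
Definition geod (s t : T) : seq T := s :: xchoose (simple_path_ex G s t).

Definition edge (s t : T) : {set T} := [set s; t].

Definition geod_edges (s t : T) : {set {set T}} :=
  [set:: [seq edge e.1 e.2 | e <- zip (geod s t) (behead (geod s t))]].

Definition prec (s t : T) : bool := s \in geod t (tree_root G).

Definition common_ancestor (s t v : T) : bool :=
  (v \in geod s (tree_root G)) && (v \in geod t (tree_root G)).

(* The default value is never used: the greatest common ancestor exists. *)
Definition meet (s t : T) : T :=
  odflt (tree_root G) [pick v | common_ancestor s t v
                         & [forall w, common_ancestor s t w ==> prec w v]].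

(* The larger of two comparable vertices. *)
Definition larger (s t : T) : T := if prec s t then t else s.

Definition successors (t : T) : {set T} :=
  [set s | [&& adj G t s, s != t & prec t s]].

Definition leaf (t : T) : bool := successors t == set0.

End RootedTrees.

(* lchild t and rchild t are t^- and t^+; they are only meaningful at
   non-leaves. *)
Record dyadic_tree (T : finType) := DyadicTree {
  dtree :> rooted_tree T;
  lchild : T -> T;
  rchild : T -> T;
  children_neq : forall t, ~~ leaf dtree t -> lchild t != rchild t;
  childrenE : forall t, ~~ leaf dtree t ->
    successors dtree t = [set lchild t; rchild t]
}.

Section UMatrices.
Variables (R : realFieldType) (n : nat) (T : finType) (D : dyadic_tree T).

(* lab numbers the leaves by 'I_n.+1, i.e. from 0 to n; the distinguished leaf
   is the one with the largest number. *)
Record leaf_labelling (lab : 'I_n.+1 -> T) : Prop := LeafLabelling {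
  lab_inj : injective lab;
  lab_leaf : forall t, leaf D t <-> exists i, lab i = t;
  lab_lt : forall i j : 'I_n.+1, i != j ->
    ((i < j)%N <-> prec D (lchild D (meet D (lab i) (lab j))) (lab i) /\
                   prec D (rchild D (meet D (lab i) (lab j))) (lab j))
}.

Variables (lab : 'I_n.+1 -> T) (alpha beta : T -> R).

Definition on_spine (t : T) : bool := t \in geod D (tree_root D) (lab ord_max).

Record supports (U : 'M[R]_n.+1) : Prop := Supports {
  alpha_ge0 : forall t, 0 <= alpha t;
  beta_ge0 : forall t, 0 <= beta t;
  alpha_beta_leaf : forall t, leaf D t -> alpha t = beta t;
  alpha_meet : forall t, ~~ leaf D t -> prec D (rchild D (tree_root D)) t ->
    alpha t = alpha (meet D t (lab ord_max));
  alpha_le_beta : forall t, alpha t <= beta t;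
  alpha_mono : forall t s, prec D t s -> alpha t <= alpha s;
  beta_mono : forall t s, prec D t s -> beta t <= beta s;
  spine_rchild : forall t, ~~ leaf D t -> on_spine t -> on_spine (rchild D t);
  spine_alpha_beta : forall t, on_spine t -> alpha t = beta t;
  entry_diag : forall i, U i i = alpha (lab i);
  entry_lr : forall i j : 'I_n.+1, i != j ->
    let t := meet D (lab i) (lab j) in
    prec D (lchild D t) (lab i) -> prec D (rchild D t) (lab j) ->
    U i j = alpha t;
  entry_rl : forall i j : 'I_n.+1, i != j ->
    let t := meet D (lab i) (lab j) in
    prec D (rchild D t) (lab i) -> prec D (lchild D t) (lab j) ->
    U i j = beta (larger D t (meet D (lab i) (lab ord_max)))
}.

Definition leaves_below (L : T) : {set 'I_n.+1} := [set i | prec D L (lab i)].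

Definition Nplus (i : 'I_n.+1) : {set T} :=
  [set L | prec D L (lab i) && (alpha L == alpha (lab i))].

Definition Nminus (i : 'I_n.+1) : {set T} :=
  [set L | prec D L (lab i) && (beta L == beta (lab i))].

Definition lchild_in_Gamma (L : T) : bool :=
  on_spine L || [exists i in leaves_below (rchild D L), L \in Nminus i].

Definition rchild_in_Gamma (L : T) : bool :=
  ~~ on_spine L && [exists i in leaves_below (lchild D L), L \in Nplus i].

Definition Gamma : {set {set T}} :=
  [set edge L (lchild D L) | L : T & ~~ leaf D L && lchild_in_Gamma L]
  :|: [set edge L (rchild D L) | L : T & ~~ leaf D L && rchild_in_Gamma L].

End UMatrices.

Section Potentials.
Variables (R : realFieldType) (n : nat) (U : 'M[R]_n) (A : {set 'I_n}).

(* The rows and columns of the principal submatrix are the ranks in enum A of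
   the elements of A. *)
Definition principal_submx : 'M[R]_#|A| :=
  mxsub (@enum_val _ (mem A)) (@enum_val _ (mem A)) U.

Definition potential : 'cV[R]_#|A| := invmx principal_submx^T *m const_mx 1.

Definition exiting_roots : {set 'I_n} :=
  [set enum_val k | k : 'I_#|A| & 0 < potential k 0].

End Potentials.

(* Main.v *)
(* Every row of U is constant outside the diagonal block hanging from the spine
   geod(r, n), and the row of n is constant: at a spine vertex the potential is
   e_n / alpha_n. Off the spine, U_L has diagonal blocks U_J, U_K (J = L^-,
   K = L^+) and constant off-diagonal blocks a = alpha_L, b = beta_L. Writing
   m, k for the total masses of nu_J, nu_K and d = 1 - a b m k,
     nu_L = ((1 - b k) / d * nu_J, (1 - a m) / d * nu_K),
   so that the coordinates of J are killed exactly when b k = 1, and those of K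
   exactly when a m = 1. The induction carries the statement that, for
   0 <= c <= beta_L, c * mass(nu_L) <= 1, with equality iff c is the diagonal
   entry of a leaf of L; this is what turns b k = 1 and a m = 1 into membership
   in Gamma. If d = 0 then (nu_J, - nu_K) has total mass 0 and lies in the
   kernel of U_L^T; as the entries of U in a column outside L are constant on L,
   extending it by 0 would make U singular. *)
Require Import Defs.
From mathcomp Require Import all_boot all_order all_algebra.
From mathcomp Require Import ring lra zify.
Set Implicit Arguments.
Unset Strict Implicit.
Unset Printing Implicit Defensive.
Import Order.TTheory GRing.Theory Num.Theory.
Local Open Scope ring_scope.

(** * Geodesics and the ancestor order of a rooted tree *)

Section RootedTreeOrder.
Variables (T : finType) (G : rooted_tree T).
Implicit Types s t u v w : T.

Local Notation root := (tree_root G).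

Lemma geod_simple_path s t : simple_path (adj G) s t (behead (geod G s t)).
Proof. exact: xchooseP (simple_path_ex G s t). Qed.

Lemma geodE s t p : simple_path (adj G) s t p -> geod G s t = s :: p.
Proof.
by move=> sp; congr cons; apply: simple_path_uniq (geod_simple_path s t) sp.
Qed.

Lemma geod_uniq s t : uniq (geod G s t).
Proof. by case/and3P: (geod_simple_path s t). Qed.

Lemma geod_self s : geod G s s = [:: s].
Proof. by apply: geodE; rewrite /simple_path /= eqxx. Qed.

Lemma geod_adj s t : adj G s t -> geod G s t = [:: s; t].
Proof.
move=> st; apply: geodE; rewrite /simple_path /= st eqxx /= inE andbT.
by apply/eqP=> eq_st; rewrite eq_st adj_irr in st.
Qed.

Lemma geod_source s t : s \in geod G s t.
Proof. exact: mem_head. Qed.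

Lemma geod_target s t : t \in geod G s t.
Proof.
case/and3P: (geod_simple_path s t) => _ /eqP last_t _.
by rewrite -[X in X \in _]last_t; apply: mem_last.
Qed.

(** Cutting a simple path at one of its vertices leaves two simple paths, and uniqueness makes them
    geodesics. *)
Lemma geod_split s t v : v \in geod G s t ->
  geod G s t = geod G s v ++ behead (geod G v t).
Proof.
have := geod_simple_path s t; rewrite -[geod G s t]/(s :: behead (geod G s t)).
move: (behead (geod G s t)) => p /and3P[+ + + vp].
case/splitPl: vp => p1 p2 last_v; rewrite cat_path last_cat last_v -cat_cons.
rewrite cat_uniq => /andP[path1 path2] last_t /and3P[uniq1 disj uniq2].
rewrite (@geodE s v p1) ?(@geodE v t p2) //.
  rewrite /simple_path path2 last_t /= uniq2 andbT.
  apply: contra disj => v2; apply/hasP; exists v => //.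
  by rewrite -last_v mem_last.
by rewrite /simple_path path1 last_v eqxx.
Qed.

Lemma geod_rev s t : geod G t s = rev (geod G s t).
Proof.
have := geod_simple_path s t; rewrite -[geod G s t]/(s :: behead (geod G s t)).
move: (behead (geod G s t)) => p /and3P[path_p /eqP last_p uniq_p].
have rev_p : rev (s :: p) = t :: rev (belast s p).
  by rewrite lastI last_p rev_rcons.
rewrite rev_p; apply: geodE; apply/and3P; split.
- rewrite -last_p rev_path (eq_path (e' := adj G)) // => x y /=.
  by rewrite adj_sym.
- apply/eqP; rewrite -[last _ _]/(last s (t :: rev (belast s p))) -rev_p.
  by rewrite rev_cons last_rcons.
- by rewrite -rev_p rev_uniq.
Qed.

Lemma prec_refl t : prec G t t.
Proof. exact: geod_source. Qed.

Lemma prec_root t : prec G root t.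
Proof. exact: geod_target. Qed.

Lemma prec_trans t s u : prec G s t -> prec G t u -> prec G s u.
Proof.
rewrite /prec => st tu; rewrite (geod_split tu) mem_cat.
by move: st; rewrite inE => /predU1P[->|->]; rewrite ?geod_target ?orbT.
Qed.

(** Ancestors of [t] correspond to suffixes of one list, so that [prec_total] and [prec_anti] reduce
    to comparing lengths. *)
Lemma prec_drop s t : prec G s t ->
  exists2 k, geod G s root = drop k (geod G t root) &
             (k < size (geod G t root))%N.
Proof.
move=> st; have [q qE] : exists q, geod G t s = rcons q s.
  have := geod_simple_path t s.
  rewrite -[geod G t s]/(t :: behead (geod G t s)).
  move: (behead (geod G t s)) => p /and3P[_ /eqP last_p _].
  by exists (belast t p); rewrite -[in RHS]last_p -lastI.
exists (size q); rewrite (geod_split st) qE cat_rcons.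
  by rewrite drop_size_cat.
by rewrite size_cat /= addnS ltnS leq_addr.
Qed.

Lemma prec_total s u t : prec G s t -> prec G u t -> prec G s u || prec G u s.
Proof.
move=> /prec_drop[k sk _] /prec_drop[m um _].
wlog le_mk : s u k m sk um / (m <= k)%N => [IH|].
  case/orP: (leq_total m k) => le; [exact: (IH s u k m)|].
  by rewrite orbC; exact: (IH u s m k).
apply/orP; left; have := geod_source s root.
by rewrite sk -(subnK le_mk) -drop_drop -um => /mem_drop.
Qed.

Lemma prec_anti s t : prec G s t -> prec G t s -> s = t.
Proof.
move=> /prec_drop[k sk kt] /prec_drop[m tm _].
have sz : size (geod G t root) = (size (geod G t root) - k - m)%N.
  by rewrite {1}tm sk !size_drop.
have k0 : k = 0%N by lia.
by move: sk; rewrite k0 drop0 => - [].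
Qed.

Lemma successors_geod s t :
  s \in successors G t -> geod G s root = s :: geod G t root.
Proof.
rewrite inE => /and3P[ts _ /geod_split ->].
by rewrite geod_adj // adj_sym.
Qed.

Lemma successors_prec s t : s \in successors G t -> prec G t s.
Proof. by rewrite inE => /and3P[]. Qed.

Lemma successors_neq s t : s \in successors G t -> s != t.
Proof. by rewrite inE => /and3P[]. Qed.

Lemma prec_successor s t w : s \in successors G t ->
  prec G w s = (w == s) || prec G w t.
Proof. by move=> /successors_geod E; rewrite {1}/prec E inE. Qed.

Lemma successor_not_prec s t : s \in successors G t -> ~~ prec G s t.
Proof.
move=> st; apply: contra (successors_neq st) => /prec_anti -> //.
exact: successors_prec.
Qed.

Lemma successor_exists t v : prec G t v -> v != t ->
  exists2 s, s \in successors G t & prec G s v.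
Proof.
move=> tv vt; have := geod_simple_path t v.
rewrite /simple_path; case E: (behead (geod G t v)) => [|s p] /and3P[].
  by move=> _ /=; rewrite eq_sym (negPf vt).
move=> /= /andP[ts _] _ /andP[tsp _]; exists s; last first.
  rewrite /prec (geod_split tv) mem_cat geod_rev mem_rev.
  by rewrite -[geod G t v]/(t :: behead (geod G t v)) E !inE eqxx orbT.
have s_tv : s \in geod G v t.
  rewrite geod_rev mem_rev -[geod G t v]/(t :: behead (geod G t v)) E.
  by rewrite !inE eqxx orbT.
have st : s != t by apply: contraNneq tsp => <-; rewrite mem_head.
rewrite inE ts st /=.
have sv : prec G s v by rewrite /prec (geod_split tv) mem_cat s_tv.
(* If [s] preceded [t], it would occur in both halves of the geodesic from [v] to the root cut at
   [t], which has no repetition. *)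
case/orP: (prec_total tv sv) => // le_st.
have := geod_uniq v root; rewrite (geod_split tv) cat_uniq => /and3P[_ /hasP[]].
exists s => //; move: le_st.
by rewrite /prec inE (negPf st).
Qed.

Lemma successor_unique t s s' v :
  s \in successors G t -> s' \in successors G t ->
  prec G s v -> prec G s' v -> s = s'.
Proof.
move=> ss ss' sv s'v; case/orP: (prec_total sv s'v) => h.
  move: h; rewrite (prec_successor _ ss') (negPf (successor_not_prec ss)).
  by rewrite orbF => /eqP.
move: h; rewrite (prec_successor _ ss) (negPf (successor_not_prec ss')).
by rewrite orbF => /eqP.
Qed.

(** Induction from the leaves to the root, on the number of vertices that [t] precedes. *)
Lemma tree_ind (P : T -> Prop) :
  (forall t, (forall s, s \in successors G t -> P s) -> P t) -> forall t, P t.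
Proof.
move=> step t; have [m] := ubnP #|[set u | prec G t u]|.
elim: m t => // m IH t le_m; apply: step => s st; apply: IH.
rewrite ltnS in le_m; apply: leq_trans le_m; apply: proper_card.
apply/properP; split.
  by apply/subsetP=> u; rewrite !inE; apply/prec_trans/successors_prec.
by exists t; rewrite inE ?prec_refl // successor_not_prec.
Qed.

Lemma meetE s t v : common_ancestor G s t v ->
  (forall w, common_ancestor G s t w -> prec G w v) -> meet G s t = v.
Proof.
move=> sv max_v; rewrite /meet; case: pickP => [w /andP[sw max_w]|none] /=.
  by apply: prec_anti; [apply: max_v | apply: (implyP (forallP max_w v))].
have /negP[] := negbT (none v).
by rewrite sv; apply/forallP=> w; apply/implyP/max_v.
Qed.

Lemma meet_precr s t : prec G (meet G s t) t.
Proof.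
by rewrite /meet; case: pickP => [w /andP[/andP[]]|none] //=; apply: prec_root.
Qed.

Lemma meet_prec s t : prec G s t -> meet G s t = s.
Proof.
move=> st; apply: meetE => [|w /andP[]//].
by rewrite /common_ancestor geod_source.
Qed.

Lemma meet_successors t s s' u v : s \in successors G t ->
  s' \in successors G t -> s != s' -> prec G s u -> prec G s' v ->
  meet G u v = t.
Proof.
move=> ss ss' neq su s'v; apply: meetE => [|w /andP[wu wv]].
  apply/andP; split; first exact: prec_trans (successors_prec ss) su.
  exact: prec_trans (successors_prec ss') s'v.
(* A common ancestor [w] is comparable with [s]. If [s] preceded or equalled [w], it would also
   precede [v], forcing [s = s']; so [w] precedes [t]. *)
case/orP: (prec_total su wu) => [sw|].
  by rewrite (successor_unique ss ss' (prec_trans sw wv) s'v) eqxx in neq.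
rewrite (prec_successor _ ss) => /predU1P[ws|//].
by rewrite -ws in ss neq; rewrite (successor_unique ss ss' wv s'v) eqxx in neq.
Qed.

Lemma geod_edges_self t : geod_edges G t t = set0.
Proof. by rewrite /geod_edges geod_self; apply/setP=> x; rewrite !inE. Qed.

Lemma geod_edges_successor t s v : s \in successors G t -> prec G s v ->
  geod_edges G v t = edge t s |: geod_edges G v s.
Proof.
move=> st sv; have E : geod G v t = rcons (geod G v s) t.
  have tv := prec_trans (successors_prec st) sv.
  have svt : s \in geod G v t.
    have := sv; rewrite /prec (geod_split tv) mem_cat => /orP[//|].
    by move=> /mem_behead; rewrite [_ \in _](negPf (successor_not_prec st)).
  rewrite (geod_split svt) (@geod_adj s t) /= ?cats1 //.
  by rewrite adj_sym; move: st; rewrite inE => /and3P[].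
rewrite /geod_edges E -[geod G v s]/(v :: behead (geod G v s)).
have := geod_simple_path v s.
move: (behead (geod G v s)) => p /and3P[_ /eqP last_p _].
(* [zip] pairs each vertex with the next one, so appending [t] adds only the pair [(s, t)]. *)
have zip_p : zip (v :: rcons p t) (rcons p t) = rcons (zip (v :: p) p) (s, t).
  by elim: p v last_p {sv E} => [|x p IH] v /= => [->|/IH->].
rewrite /= zip_p map_rcons /edge (setUC [set t]).
by apply/setP=> z; rewrite !inE mem_rcons inE.
Qed.

(** Edges are unordered, so the crossed matching has to be excluded: it would make each end a
    successor of the other. *)
Lemma edge_inj t s t' s' : s \in successors G t -> s' \in successors G t' ->
  edge t s = edge t' s' -> t = t' /\ s = s'.
Proof.
move=> st st' E; have ns' := successors_neq st'.
have /set2P[tt'|ts'] : t \in edge t' s' by rewrite -E set21.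
  split=> //; have /set2P[st1|//] : s \in edge t' s' by rewrite -E set22.
  by have := successors_neq st; rewrite st1 tt' eqxx.
have /set2P[t't|t's] : t' \in edge t s by rewrite E set21.
  by rewrite t't ts' eqxx in ns'.
by have := successor_not_prec st'; rewrite -ts' t's (successors_prec st).
Qed.

End RootedTreeOrder.

(** * Potentials of principal submatrices as functions on all indices *)

Section Potentials.
Variables (R : realFieldType) (n : nat).
Implicit Types (U : 'M[R]_n) (A : {set 'I_n}) (x y nu : 'I_n -> R).

Lemma unitmx_ker U x : U \in unitmx ->
  (forall j, \sum_i U i j * x i = 0) -> forall i, x i = 0.
Proof.
move=> unitU xU0 i; have : (\row_i x i) *m U = 0.
  apply/rowP=> j; rewrite !mxE -[RHS](xU0 j); apply: eq_bigr => k _.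
  by rewrite !mxE mulrC.
by move=> /(canRL (mulmxK unitU)); rewrite mul0mx => /rowP/(_ i); rewrite !mxE.
Qed.

(** Trades the inverse of the submatrix, indexed by ranks in [enum A], for sums over [A]: a trivial
    kernel gives invertibility, and then any solution is the potential. *)
Lemma exiting_rootsE U A nu :
    {in A, forall j, \sum_(i in A) U i j * nu i = 1} ->
    (forall y, {in A, forall j, \sum_(i in A) U i j * y i = 0} ->
       {in A, forall i, y i = 0}) ->
  {in A, forall i, (i \in exiting_roots U A) = (0 < nu i)}.
Proof.
move=> nu1 kerU.
have sumE (F : 'I_n -> R) : \sum_(k < #|A|) F (enum_val k) = \sum_(i in A) F i.
  by rewrite [RHS]big_enum_val.
have unitA : (principal_submx U A)^T \in unitmx.
  rewrite unitmx_tr -row_free_unit; apply: inj_row_free => v vU0.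
  apply/rowP=> k; rewrite mxE.
  (* [k] witnesses that [A] is nonempty, as [enum_rank_in] demands; the values of [y] outside [A]
     never enter a sum over [A]. *)
  pose y i := v 0 (enum_rank_in (enum_valP k) i).
  rewrite -[LHS]/(v 0 k) -[k](enum_valK_in (enum_valP k)) -/(y _).
  apply: kerU (enum_valP k) => j Aj; rewrite -sumE.
  move/rowP: vU0 => /(_ (enum_rank_in (enum_valP k) j)); rewrite !mxE => vUj.
  rewrite -[RHS]vUj.
  apply: eq_bigr => l _.
  by rewrite /y enum_valK_in !mxE enum_rankK_in // mulrC.
have potE : potential U A = \col_k nu (enum_val k).
  rewrite /potential; apply: (canLR (mulKmx unitA)); apply/colP=> k.
  rewrite !mxE -[LHS](nu1 _ (enum_valP k)) -sumE; apply: eq_bigr => l _.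
  by rewrite !mxE.
rewrite /exiting_roots potE => i Ai.
apply/imsetP/idP => [[k + ->]|nu_i]; first by rewrite inE mxE.
exists (enum_rank_in Ai i); last by rewrite enum_rankK_in.
by rewrite inE mxE enum_rankK_in.
Qed.

End Potentials.

(** * Scalar inequalities for gluing two blocks *)

Lemma mulr_ge0_gt0 (R : realFieldType) (x y : R) : 0 <= x -> 0 <= y ->
  (0 < x * y) = (x != 0) && (0 < y).
Proof.
rewrite le_eqVlt => /predU1P[<-|x0] y0; first by rewrite mul0r ltxx eqxx.
by rewrite pmulr_rgt0 // gt_eqF.
Qed.

(* 1 - a b m k is the ratio det U_L / (det U_J det U_K) for the block matrix
   with diagonal blocks U_J, U_K and off-diagonal entries a and b, where m and k
   are the masses of the potentials of the blocks; N in two_block_mass is then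
   this ratio times 1 - c (mass of L). *)
Section TwoBlocks.
Variables (R : realFieldType) (a b m k : R).
Hypotheses (a_ge0 : 0 <= a) (le_ab : a <= b) (m_gt0 : 0 < m) (k_gt0 : 0 < k).
Hypotheses (bm_le1 : b * m <= 1) (bk_le1 : b * k <= 1).

Let b_ge0 : 0 <= b := le_trans a_ge0 le_ab.

Lemma two_block_det_ge0 : 0 <= 1 - a * b * m * k.
Proof.
have am1 : a * m <= 1 by apply: le_trans bm_le1; rewrite ler_pM2r.
have am0 : 0 <= a * m by rewrite mulr_ge0 // ltW.
have bk0 : 0 <= b * k by rewrite mulr_ge0 // ltW.
have -> : a * b * m * k = a * m * (b * k) by ring.
by rewrite subr_ge0 mulr_ile1.
Qed.

Lemma two_block_det_eq0 :
  1 - a * b * m * k = 0 -> [/\ a * m = 1, b * m = 1 & b * k = 1].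
Proof.
move=> det0.
have amb : a * m <= b * m by rewrite ler_pM2r.
have am0 : 0 <= a * m by rewrite mulr_ge0 // ltW.
have bk0 : 0 <= b * k by rewrite mulr_ge0 // ltW.
have am_le1 : a * m <= 1 by apply: le_trans bm_le1.
(* A product of two numbers in [0, 1] equals 1 only if both do. *)
have e : a * m * (b * k) = 1.
  by apply/eqP; rewrite eq_sym -subr_eq0 -det0; apply/eqP; ring.
have am1 : a * m = 1.
  by apply: le_anti; rewrite am_le1 -[X in X <= _]e ler_piMr.
split=> //; last by rewrite am1 mul1r in e.
by apply: le_anti; rewrite bm_le1 -am1.
Qed.

Hypothesis det_neq0 : 1 - a * b * m * k != 0.

Lemma two_block_mass (c : R) : 0 <= c <= b ->
  let N := (1 - c * m) * (1 - c * k) - (c - a) * (c - b) * m * k in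
  (0 <= N) * ((N == 0) = (c * m == 1) || (c * k == 1)).
Proof.
(* At [c = b] the subtracted term vanishes and [N] factors. For [c < b] neither equality can hold,
   and [N] has to be shown positive. *)
case/andP=> c0; rewrite le_eqVlt => /predU1P[-> N|cb N].
  rewrite /N subrr mulr0 !mul0r subr0; split.
    by rewrite mulr_ge0 ?subr_ge0.
  by rewrite mulf_eq0 !subr_eq0 !(eq_sym 1).
have cm : c * m < 1 by apply: lt_le_trans bm_le1; rewrite ltr_pM2r.
have ck : c * k < 1 by apply: lt_le_trans bk_le1; rewrite ltr_pM2r.
suff N0 : 0 < N by rewrite ltW // gt_eqF // !lt_eqF.
rewrite /N; have [ac|ca] := leP a c.
  have : 0 < (1 - c * m) * (1 - c * k) by rewrite mulr_gt0 ?subr_gt0.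
  have : 0 <= (c - a) * (b - c) * (m * k).
    by rewrite !mulr_ge0 ?subr_ge0 ?(ltW m_gt0) ?(ltW k_gt0) // ltW.
  nra.
have am1 : a * m <= 1 by apply: le_trans bm_le1; rewrite ler_pM2r.
(* Expand with [1 - c * m = (1 - a * m) + (a - c) * m] and [1 - c * k = (1 - b * k) + (b - c) * k]:
   the product of the increments cancels the subtracted term. *)
have -> : (1 - c * m) * (1 - c * k) - (c - a) * (c - b) * m * k =
  (1 - a * m) * (1 - b * k) + (1 - a * m) * ((b - c) * k)
    + (1 - b * k) * ((a - c) * m) by ring.
have u0 : 0 < (b - c) * k by rewrite mulr_gt0 ?subr_gt0.
have v0 : 0 < (a - c) * m by rewrite mulr_gt0 ?subr_gt0.
have xy0 : 0 <= (1 - a * m) * (1 - b * k) by rewrite mulr_ge0 ?subr_ge0.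
have xu0 : 0 <= (1 - a * m) * ((b - c) * k).
  by rewrite mulr_ge0 ?subr_ge0 // ltW.
have yv0 : 0 <= (1 - b * k) * ((a - c) * m).
  by rewrite mulr_ge0 ?subr_ge0 // ltW.
(* All three summands are nonnegative. If [a * m = 1], then [b * k] is not 1 because the determinant
   ratio is nonzero, and the last summand is positive; otherwise the middle one is. *)
move: am1; rewrite le_eqVlt => /predU1P[am1|am1].
  have : 0 < (1 - b * k) * ((a - c) * m); last by lra.
  rewrite pmulr_lgt0 // subr_gt0 lt_neqAle bk_le1 andbT.
  by apply: contra det_neq0 => /eqP bk1; apply/eqP; nra.
have : 0 < (1 - a * m) * ((b - c) * k); last by lra.
by rewrite mulr_gt0 ?subr_gt0.
Qed.

End TwoBlocks.

(** * Entries of the matrix read off the tree *)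

Section UMatrixEntries.
Variables (R : realFieldType) (n : nat) (T : finType) (D : dyadic_tree T).
Variables (lab : 'I_n.+1 -> T) (alpha beta : T -> R) (U : 'M[R]_n.+1).
Hypotheses (labD : leaf_labelling D lab) (suppU : supports D lab alpha beta U).
Implicit Types (s t u v L : T) (i j k : 'I_n.+1).

Local Notation below := (leaves_below D lab).
Local Notation lc := (lchild D).
Local Notation rc := (rchild D).
Local Notation spine := (on_spine D lab).

Lemma lchild_successor t : ~~ leaf D t -> lc t \in successors D t.
Proof. by move=> /childrenE ->; rewrite set21. Qed.

Lemma rchild_successor t : ~~ leaf D t -> rc t \in successors D t.
Proof. by move=> /childrenE ->; rewrite set22. Qed.

Lemma successor_nonleaf s t : s \in successors D t -> ~~ leaf D t.
Proof. by move=> st; apply/set0Pn; exists s. Qed.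

Lemma successorP s t : s \in successors D t -> s = lc t \/ s = rc t.
Proof.
by move=> st; apply/set2P; rewrite -childrenE // (successor_nonleaf st).
Qed.

Lemma leaf_prec t v : leaf D t -> prec D t v -> v = t.
Proof.
move=> leaf_t tv; apply: contraTeq leaf_t => /(successor_exists tv)[s st _].
exact: successor_nonleaf st.
Qed.

Lemma leaf_lab i : leaf D (lab i).
Proof. by apply/(lab_leaf labD); exists i. Qed.

Lemma prec_nonleaf_lab t i : ~~ leaf D t ->
  prec D t (lab i) = prec D (lc t) (lab i) || prec D (rc t) (lab i).
Proof.
move=> nt; apply/idP/orP => [ti|[]]; last 2 first.
- exact/prec_trans/successors_prec/lchild_successor.
- exact/prec_trans/successors_prec/rchild_successor.
case: (successor_exists ti) => [|s /successorP[]->]; [|by left|by right].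
by apply: contraNneq nt => <-; apply: leaf_lab.
Qed.

Lemma children_disjoint t v : ~~ leaf D t -> prec D (lc t) v ->
  prec D (rc t) v = false.
Proof.
move=> nt lv; apply: contraNF (children_neq nt) => rv; apply/eqP.
exact: successor_unique (lchild_successor nt) (rchild_successor nt) lv rv.
Qed.

Lemma below_prec s t i : prec D s t -> i \in below t -> i \in below s.
Proof. by rewrite !inE; apply: prec_trans. Qed.

Lemma leaves_below_node t : ~~ leaf D t ->
  below t = below (lc t) :|: below (rc t).
Proof. by move=> nt; apply/setP=> i; rewrite !inE prec_nonleaf_lab. Qed.

Lemma leaves_below_disjoint t : ~~ leaf D t ->
  [disjoint below (lc t) & below (rc t)].
Proof.
move=> nt; rewrite disjoint_subset; apply/subsetP=> i.
by rewrite !inE => /(children_disjoint nt) ->.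
Qed.

Lemma leaves_below_lab i : below (lab i) = [set i].
Proof.
apply/setP=> j; rewrite !inE; apply/idP/eqP=> [|->]; last exact: prec_refl.
by move=> /(leaf_prec (leaf_lab i)) /(lab_inj labD).
Qed.

(** From the root, follow the child that precedes both leaves until they part. *)
Lemma leaves_branch i j : i != j ->
  exists t s s', [/\ s \in successors D t, s' \in successors D t, s != s',
                     i \in below s & j \in below s'].
Proof.
move=> ij; have := prec_root D (lab i); have := prec_root D (lab j).
move: (tree_root D); apply: (tree_ind (G := D)) => t IH tj ti.
have nt : ~~ leaf D t.
  apply: contra ij => leaf_t; apply/eqP/(lab_inj labD).
  by rewrite (leaf_prec leaf_t ti) (leaf_prec leaf_t tj).
have ls := lchild_successor nt; have rs := rchild_successor nt.
have lr := children_neq nt.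
have := ti; have := tj; rewrite (prec_nonleaf_lab j nt) (prec_nonleaf_lab i nt).
case/orP=> [lj|rj] /orP[li|ri].
- exact: IH lj li.
- by exists t, (rc t), (lc t); split; rewrite // ?[_ \in below _]inE // eq_sym.
- by exists t, (lc t), (rc t); split; rewrite // inE.
- exact: IH rj ri.
Qed.

Lemma successor_pairP s s' t : s \in successors D t -> s' \in successors D t ->
  s != s' -> (s = lc t /\ s' = rc t) \/ (s = rc t /\ s' = lc t).
Proof.
by move=> /successorP[]-> /successorP[]->; rewrite ?eqxx //; [left|right].
Qed.

Lemma spineE t : spine t = prec D t (lab ord_max).
Proof. by rewrite /on_spine geod_rev mem_rev. Qed.

Lemma spine_below t : spine t = (ord_max \in below t).
Proof. by rewrite spineE inE. Qed.

Lemma spine_prec s t : prec D s t -> spine t -> spine s.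
Proof. by rewrite !spineE; apply: prec_trans. Qed.

Lemma lchild_off_spine t : ~~ leaf D t -> spine t -> ~~ spine (lc t).
Proof.
move=> nt st; have := spine_rchild suppU nt st; rewrite !spineE.
by apply: contraL => /(children_disjoint nt) ->.
Qed.

Lemma entry_children_lr t i j : ~~ leaf D t ->
  i \in below (lc t) -> j \in below (rc t) -> U i j = alpha t.
Proof.
rewrite !inE => nt li rj.
have mt : meet D (lab i) (lab j) = t.
  apply: meet_successors (lchild_successor nt) (rchild_successor nt) _ li rj.
  exact: children_neq.
have ij : i != j by apply: contraTneq rj => <-; rewrite children_disjoint.
by have := entry_lr suppU ij; rewrite /= mt; apply.
Qed.

Lemma entry_children_rl t i j : ~~ leaf D t ->
  i \in below (rc t) -> j \in below (lc t) ->
  U i j = beta (larger D t (meet D (lab i) (lab ord_max))).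
Proof.
rewrite !inE => nt ri lj.
have mt : meet D (lab i) (lab j) = t.
  apply: meet_successors (rchild_successor nt) (lchild_successor nt) _ ri lj.
  by rewrite eq_sym children_neq.
have ij : i != j by apply: contraTneq ri => ->; rewrite children_disjoint.
by have := entry_rl suppU ij; rewrite /= mt; apply.
Qed.

(** The meet with the last leaf is on the spine, so an off-spine [t] cannot precede it and [larger]
    returns [t]. *)
Lemma entry_children_rl_off_spine t i j : ~~ leaf D t -> ~~ spine t ->
  i \in below (rc t) -> j \in below (lc t) -> U i j = beta t.
Proof.
move=> nt off ri lj; rewrite (entry_children_rl nt ri lj) /larger.
case: ifP => // /prec_trans/(_ (meet_precr D _ _)).
by rewrite -spineE (negPf off).
Qed.

(** [s] and [L] are both ancestors of [i], hence comparable, and no vertex lies strictly between [t]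
    and its successor [s]. *)
Lemma prec_branch t s L i : s \in successors D t ->
  i \in below s -> i \in below L -> ~~ prec D L t -> prec D s L.
Proof.
move=> st; rewrite !inE => si Li nLt; case/orP: (prec_total si Li) => //.
by rewrite (prec_successor _ st) (negPf nLt) orbF => /eqP->; apply: prec_refl.
Qed.

Lemma entry_spine_lchild t i j : ~~ leaf D t -> spine t ->
  i \in below (lc t) -> j \notin below (lc t) -> U i j = alpha t.
Proof.
move=> nt st li nlj; have [tj|ntj] := boolP (j \in below t).
  apply: entry_children_lr => //; move: tj.
  by rewrite leaves_below_node // inE (negPf nlj).
have ti : i \in below t by rewrite leaves_below_node // inE li.
have ij : i != j by apply: contraNneq nlj => <-.
have [u [s [s' [su s'u ss' si s'j]]]] := leaves_branch ij.
have nu := successor_nonleaf su.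
have nut : ~~ prec D t u.
  apply: contra ntj => tu.
  exact: below_prec (prec_trans tu (successors_prec s'u)) s'j.
have st_prec : prec D s t := prec_branch su si ti nut.
have ut : prec D u t := prec_trans (successors_prec su) st_prec.
(* Here [j] parts from [i] at a proper ancestor [u] of [t]. Since [s] precedes the spine vertex [t],
   it is the right child of [u]; the larger of [u] and the meet of [i] with the last leaf is then
   [t]. *)
have [[sE _]|[sE s'E]] := successor_pairP su s'u ss'.
  have := lchild_off_spine nu (spine_prec ut st).
  by rewrite -sE (spine_prec st_prec st).
rewrite sE in si; rewrite s'E in s'j.
rewrite (entry_children_rl nu si s'j).
have -> : meet D (lab i) (lab ord_max) = t.
  have rn := spine_rchild suppU nt st; rewrite spineE in rn; rewrite inE in li.
  apply: meet_successors (lchild_successor nt) (rchild_successor nt) _ li rn.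
  exact: children_neq.
by rewrite /larger ut -(spine_alpha_beta suppU).
Qed.

Lemma entry_last_row j : U ord_max j = alpha (lab ord_max).
Proof.
have [->|nj] := eqVneq j ord_max; first exact: entry_diag suppU _.
rewrite eq_sym in nj.
have [u [s [s' [su s'u ss' si s'j]]]] := leaves_branch nj.
have nu := successor_nonleaf su; rewrite -spine_below in si.
have spine_u := spine_prec (successors_prec su) si.
have [[sE _]|[sE s'E]] := successor_pairP su s'u ss'.
  by have := lchild_off_spine nu spine_u; rewrite -sE si.
rewrite spine_below sE in si; rewrite s'E in s'j.
rewrite (entry_children_rl nu si s'j) meet_prec ?prec_refl //.
rewrite /larger -spineE spine_u -(spine_alpha_beta suppU) //.
by rewrite spineE prec_refl.
Qed.

Lemma spine_branch i : i != ord_max ->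
  exists t, [/\ ~~ leaf D t, spine t & i \in below (lc t)].
Proof.
move=> ni; have [t [s [s' [st s't ss' si s'j]]]] := leaves_branch ni.
have nt := successor_nonleaf st; rewrite -spine_below in s'j.
have spine_t := spine_prec (successors_prec s't) s'j.
exists t; split=> //; have [[<-]//|[_ s'E]] := successor_pairP st s't ss'.
by have := lchild_off_spine nt spine_t; rewrite -s'E s'j.
Qed.

(** If [i] is not the last leaf, it hangs from the spine in a block [lc t] contained in [L], and its
    row is constant outside that block. *)
Lemma entry_spine_col L i j : spine L -> i \in below L -> j \notin below L ->
  U i j = U i ord_max.
Proof.
move=> sL Li nLj; have [->|ni] := eqVneq i ord_max.
  by rewrite !entry_last_row.
have [t [nt st li]] := spine_branch ni.
have nl := lchild_off_spine nt st.
have nln : ord_max \notin below (lc t) by rewrite -spine_below.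
suff nlj : j \notin below (lc t) by rewrite !(entry_spine_lchild nt st li).
apply: contra nLj; apply: below_prec.
have [Lt|nLt] := boolP (prec D L t).
  exact: prec_trans Lt (successors_prec (lchild_successor nt)).
have := prec_branch (lchild_successor nt) li Li nLt.
by move=> /spine_prec/(_ sL); rewrite (negPf nl).
Qed.

(** All leaves of [L] part from [j] at the same vertex or hang from the spine in the same block
    without [j]. The common entry is an [alpha] or [beta] at an ancestor of [L], and [beta] is
    monotone. *)
Lemma entry_off_spine_col L j : ~~ spine L -> j \notin below L ->
  exists2 c, 0 <= c <= beta L & {in below L, forall i, U i j = c}.
Proof.
move=> nsL nLj.
have [L0|[i Li]] := set_0Vmem (below L).
  by exists (beta L) => [|i]; rewrite ?L0 ?inE ?(beta_ge0 suppU) ?lexx.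
have ni : i != ord_max.
  by apply: contraNneq nsL => eq_i; rewrite spine_below -eq_i.
have [t [nt st li]] := spine_branch ni; have ls := lchild_successor nt.
have nLt : ~~ prec D L t by apply: contra nsL => /spine_prec; apply.
have lL : prec D (lc t) L := prec_branch ls li Li nLt.
have [lj|nlj] := boolP (j \in below (lc t)); last first.
  exists (alpha t) => [|k]; last first.
    by move=> /(below_prec lL) lk; apply: entry_spine_lchild.
  rewrite (alpha_ge0 suppU) (spine_alpha_beta suppU st).
  exact: beta_mono suppU _ _ (prec_trans (successors_prec ls) lL).
have ij : i != j by apply: contraNneq nLj => <-.
have [u [s [s' [su s'u ss' si s'j]]]] := leaves_branch ij.
have nu := successor_nonleaf su.
have nLu : ~~ prec D L u.
  apply: contra nLj => Lu.
  exact: below_prec (prec_trans Lu (successors_prec s'u)) s'j.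
have sL : prec D s L := prec_branch su si Li nLu.
(* [lc t] precedes [u]: otherwise [s] would precede [lc t], hence both [i] and [j]. So [u] on the
   spine would put [lc t] there. *)
have off_u : ~~ spine u.
  apply: contra (lchild_off_spine nt st); apply: spine_prec.
  apply: contraT => nlu; rewrite !inE in si s'j lj.
  have sl : prec D s (lc t) by apply: (prec_branch su _ li nlu); rewrite inE.
  by rewrite (successor_unique su s'u (prec_trans sl lj) s'j) eqxx in ss'.
have uL : beta u <= beta L.
  exact: beta_mono suppU _ _ (prec_trans (successors_prec su) sL).
have [[sE s'E]|[sE s'E]] := successor_pairP su s'u ss'.
  exists (alpha u) => [|k].
    by rewrite (alpha_ge0 suppU) (le_trans (alpha_le_beta suppU u)).
  move=> /(below_prec sL) sk.
  by apply: entry_children_lr; rewrite -?s'E // -sE.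
exists (beta u) => [|k]; first by rewrite (beta_ge0 suppU) uL.
move=> /(below_prec sL) sk.
by apply: entry_children_rl_off_spine; rewrite -?s'E // -sE.
Qed.

(** * Recursion of [Gamma] and of column sums over the two children *)

Local Notation Gam := (Gamma D lab alpha beta).
Local Notation mass L nu := (\sum_(i in below L) nu i).
Local Notation colsum L y j := (\sum_(i in below L) U i j * y i).

Lemma edge_lchild_Gamma t : ~~ leaf D t ->
  (edge t (lc t) \in Gam) = lchild_in_Gamma D lab beta t.
Proof.
move=> nt; have lt := lchild_successor nt; rewrite inE; apply/idP/idP.
  case/orP=> /imsetP[u]; rewrite inE => /andP[nu gam].
    by move=> /(edge_inj lt (lchild_successor nu))[->].
  move=> /(edge_inj lt (rchild_successor nu))[<-] /eqP.
  by rewrite (negPf (children_neq nt)).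
by move=> gam; apply/orP; left; apply: imset_f; rewrite inE nt.
Qed.

Lemma edge_rchild_Gamma t : ~~ leaf D t ->
  (edge t (rc t) \in Gam) = rchild_in_Gamma D lab alpha t.
Proof.
move=> nt; have rt := rchild_successor nt; rewrite inE; apply/idP/idP.
  case/orP=> /imsetP[u]; rewrite inE => /andP[nu gam].
    move=> /(edge_inj rt (lchild_successor nu))[<-] /eqP.
    by rewrite eq_sym (negPf (children_neq nt)).
  by move=> /(edge_inj rt (rchild_successor nu))[->].
by move=> gam; apply/orP; right; apply: imset_f; rewrite inE nt.
Qed.

Lemma geod_Gamma_successor s t v : s \in successors D t -> prec D s v ->
  (geod_edges D v t :&: Gam == set0) =
  (edge t s \notin Gam) && (geod_edges D v s :&: Gam == set0).
Proof.
move=> st sv; rewrite (geod_edges_successor st sv) setIUl setU_eq0.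
by rewrite !setI_eq0 disjoints1.
Qed.

Lemma sum_below_node (F : 'I_n.+1 -> R) t : ~~ leaf D t ->
  \sum_(i in below t) F i =
  \sum_(i in below (lc t)) F i + \sum_(i in below (rc t)) F i.
Proof.
move=> nt; rewrite -bigU ?leaves_below_disjoint //=.
by apply: eq_bigl => i; rewrite leaves_below_node // !inE.
Qed.

Lemma colsum_lchild (y : 'I_n.+1 -> R) t : ~~ leaf D t -> ~~ spine t ->
  {in below (lc t), forall j,
     colsum t y j = colsum (lc t) y j + beta t * mass (rc t) y}.
Proof.
move=> nt off j lj; rewrite (sum_below_node _ nt); congr (_ + _).
rewrite mulr_sumr; apply: eq_bigr => i ri.
by rewrite (entry_children_rl_off_spine nt off ri lj).
Qed.

Lemma colsum_rchild (y : 'I_n.+1 -> R) t : ~~ leaf D t ->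
  {in below (rc t), forall j,
     colsum t y j = alpha t * mass (lc t) y + colsum (rc t) y j}.
Proof.
move=> nt j rj; rewrite (sum_below_node _ nt); congr (_ + _).
rewrite mulr_sumr; apply: eq_bigr => i li.
by rewrite (entry_children_lr nt li rj).
Qed.

(** * Trivial kernels of the blocks, from the nonsingularity of [U] *)

Hypothesis nonsingU : U \in unitmx.

Lemma below_ker L (y : 'I_n.+1 -> R) : (forall j, colsum L y j = 0) ->
  {in below L, forall i, y i = 0}.
Proof.
move=> y0 i Li; pose x k := if k \in below L then y k else 0.
have <- : x i = y i by rewrite /x Li.
apply: (unitmx_ker nonsingU) => j; rewrite -[RHS](y0 j) [RHS]big_mkcond.
by apply: eq_bigr => k _; rewrite /x; case: ifP; rewrite // mulr0.
Qed.

(** A column outside [L] agrees on [L] with that of the last leaf, which belongs to [L]; so its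
    equation is already among the hypotheses. *)
Lemma spine_ker L (y : 'I_n.+1 -> R) : spine L ->
  {in below L, forall j, colsum L y j = 0} -> {in below L, forall i, y i = 0}.
Proof.
move=> sL y0; apply: below_ker => j.
have [/y0//|nLj] := boolP (j \in below L).
rewrite -[RHS](y0 ord_max) -?spine_below //; apply: eq_bigr => i Li.
by rewrite (entry_spine_col sL Li nLj).
Qed.

(* Outside the rows of L, a column is constant on L with a value in
   [0, beta L]. *)
Lemma off_spine_ker L (y : 'I_n.+1 -> R) : ~~ spine L ->
  {in below L, forall j, colsum L y j = 0} -> beta L * mass L y = 0 ->
  {in below L, forall i, y i = 0}.
Proof.
move=> nsL y0 bm0; apply: below_ker => j.
have [/y0//|nLj] := boolP (j \in below L).
have [c /andP[c0 cL] Uc] := entry_off_spine_col nsL nLj.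
under eq_bigr => i Li do rewrite Uc //.
rewrite -mulr_sumr; apply/eqP; rewrite mulf_eq0.
move/eqP: bm0; rewrite mulf_eq0 => /orP[/eqP b0|->]; last by rewrite orbT.
by rewrite eq_le c0 andbT -b0 cL.
Qed.

(** * Potentials off the spine, by induction on the tree *)

(** The induction hypothesis. The range of [c] contains [alpha] and [beta] of the parent of [L], the
    two constants met when [L] is glued to its sibling. *)
Record off_spine_potential L (nu : 'I_n.+1 -> R) : Prop := OffSpinePotential {
  pot_eq : {in below L, forall j, colsum L nu j = 1};
  pot_ker : forall y, {in below L, forall j, colsum L y j = 0} ->
    {in below L, forall i, y i = 0};
  pot_ge0 : {in below L, forall i, 0 <= nu i};
  pot_mass_gt0 : 0 < mass L nu;
  pot_mass_le : forall c, 0 <= c <= beta L -> c * mass L nu <= 1;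
  pot_mass_eq : forall c, 0 <= c <= beta L ->
    (c * mass L nu == 1) = [exists i in below L, alpha (lab i) == c];
  pot_gt0 : {in below L, forall i,
    (0 < nu i) = (geod_edges D (lab i) L :&: Gam == set0)}
}.

Lemma off_spine_potential_lab i : ~~ spine (lab i) ->
  exists nu, off_spine_potential (lab i) nu.
Proof.
move=> off; have bE : beta (lab i) = alpha (lab i).
  by rewrite (alpha_beta_leaf suppU) // leaf_lab.
have sum1 (F : 'I_n.+1 -> R) : \sum_(k in below (lab i)) F k = F i.
  by rewrite leaves_below_lab big_set1.
have in1 k : k \in below (lab i) -> k = i.
  by rewrite leaves_below_lab => /set1P.
have Lii : i \in below (lab i) by rewrite leaves_below_lab set11.
have Uii := entry_diag suppU i.
have a0 : alpha (lab i) != 0.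
  (* With a zero diagonal entry, the constant 1 on this leaf would lie in the kernel and contradict
     [off_spine_ker]. *)
  apply/eqP=> a0; have /eqP := oner_neq0 R; apply.
  apply: (off_spine_ker (y := fun=> 1) off _ _ Lii).
    by move=> j /in1 ->; rewrite sum1 Uii a0 mul0r.
  by rewrite bE a0 mul0r.
have a_gt0 : 0 < alpha (lab i) by rewrite lt_def a0 (alpha_ge0 suppU).
exists (fun=> (alpha (lab i))^-1); split; rewrite ?sum1.
- by move=> j /in1 ->; rewrite sum1 Uii divff.
- move=> y y0 j /in1 ->; have := y0 i Lii; rewrite sum1 Uii => /eqP.
  by rewrite mulf_eq0 (negPf a0) => /eqP.
- by move=> j _; rewrite invr_ge0 ltW.
- by rewrite invr_gt0.
- by move=> c; rewrite bE => /andP[_ ca]; rewrite ler_pdivrMr ?mul1r.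
- move=> c _; rewrite -(inj_eq (mulIf a0)) mulfVK // mul1r eq_sym.
  by apply/idP/exists_inP => [?|[j /in1 ->]//]; exists i.
- move=> j /in1 ->; rewrite invr_gt0 a_gt0 geod_edges_self.
  by rewrite set0I eqxx.
Qed.

(** [alpha] and [beta] agree at leaves, so [Nminus] becomes the condition on diagonal entries that
    [pot_mass_eq] decides. *)
Lemma lchild_Gamma_off_spine t : ~~ leaf D t -> ~~ spine t ->
  lchild_in_Gamma D lab beta t =
  [exists i in below (rc t), alpha (lab i) == beta t].
Proof.
move=> nt off; rewrite /lchild_in_Gamma (negPf off).
apply: eq_existsb => i; case: (boolP (i \in below (rc t))) => //= ri.
rewrite inE (alpha_beta_leaf suppU) ?leaf_lab // eq_sym.
have := below_prec (successors_prec (rchild_successor nt)) ri.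
by rewrite inE => ->.
Qed.

Lemma rchild_Gamma_off_spine t : ~~ leaf D t -> ~~ spine t ->
  rchild_in_Gamma D lab alpha t =
  [exists i in below (lc t), alpha (lab i) == alpha t].
Proof.
move=> nt off; rewrite /rchild_in_Gamma off.
apply: eq_existsb => i; case: (boolP (i \in below (lc t))) => //= li.
rewrite inE eq_sym.
have := below_prec (successors_prec (lchild_successor nt)) li.
by rewrite inE => ->.
Qed.

Lemma off_spine_potential_node t mu ka : ~~ leaf D t -> ~~ spine t ->
  off_spine_potential (lc t) mu -> off_spine_potential (rc t) ka ->
  exists nu, off_spine_potential t nu.
Proof.
move=> nt off pmu pka.
have lt := lchild_successor nt; have rt := rchild_successor nt.
pose a := alpha t; pose b := beta t.
pose m := mass (lc t) mu; pose k := mass (rc t) ka.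
have a0 : 0 <= a := alpha_ge0 suppU t.
have ab : a <= b := alpha_le_beta suppU t.
have b0 : 0 <= b := beta_ge0 suppU t.
have bl : b <= beta (lc t) := beta_mono suppU (successors_prec lt).
have br : b <= beta (rc t) := beta_mono suppU (successors_prec rt).
have m0 : 0 < m := pot_mass_gt0 pmu.
have k0 : 0 < k := pot_mass_gt0 pka.
have cl (c : R) : 0 <= c <= b -> 0 <= c <= beta (lc t).
  by case/andP=> -> /le_trans->.
have cr (c : R) : 0 <= c <= b -> 0 <= c <= beta (rc t).
  by case/andP=> -> /le_trans->.
have bb : 0 <= b <= b by rewrite b0 /=.
have aa : 0 <= a <= b by rewrite a0 /=.
have bm1 : b * m <= 1 := pot_mass_le pmu (cl _ bb).
have bk1 : b * k <= 1 := pot_mass_le pka (cr _ bb).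
have am1 : a * m <= 1 := pot_mass_le pmu (cl _ aa).
have nrl i : i \in below (rc t) -> (i \in below (lc t)) = false.
  by apply: contraTF => li; rewrite (disjointFr (leaves_below_disjoint nt) li).
have sum_glue_l (f g : 'I_n.+1 -> R) (h : 'I_n.+1 -> R -> R) :
  \sum_(i in below (lc t)) h i (if i \in below (lc t) then f i else g i)
  = \sum_(i in below (lc t)) h i (f i).
  by apply: eq_bigr => i ->.
have sum_glue_r (f g : 'I_n.+1 -> R) (h : 'I_n.+1 -> R -> R) :
  \sum_(i in below (rc t)) h i (if i \in below (lc t) then f i else g i)
  = \sum_(i in below (rc t)) h i (g i).
  by apply: eq_bigr => i /nrl ->.
have sumZ (A : {set 'I_n.+1}) (f g : 'I_n.+1 -> R) c :
    \sum_(i in A) f i * (c * g i) = c * \sum_(i in A) f i * g i.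
  by rewrite mulr_sumr; apply: eq_bigr => i _; rewrite mulrCA.
(* The coefficients stay free because two choices follow: 1 and -1 to exclude [d = 0], then those of
   the potential. *)
have glueP p q
    (nu := fun i => if i \in below (lc t) then p * mu i else q * ka i) :
    [/\ mass (lc t) nu = p * m, mass (rc t) nu = q * k,
        {in below (lc t), forall j, colsum t nu j = p + b * (q * k)} &
        {in below (rc t), forall j, colsum t nu j = a * (p * m) + q}].
  have ml : mass (lc t) nu = p * m.
    by rewrite (sum_glue_l _ _ (fun=> id)) -mulr_sumr.
  have mr : mass (rc t) nu = q * k.
    by rewrite (sum_glue_r _ _ (fun=> id)) -mulr_sumr.
  split=> // j lj.
    rewrite colsum_lchild // mr (sum_glue_l _ _ (fun i => *%R (U i j))) sumZ.
    by rewrite (pot_eq pmu lj) mulr1.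
  rewrite colsum_rchild // ml (sum_glue_r _ _ (fun i => *%R (U i j))) sumZ.
  by rewrite (pot_eq pka lj) mulr1.
have in_t j : j \in below t -> (j \in below (lc t)) || (j \in below (rc t)).
  by rewrite leaves_below_node // inE.
pose d := 1 - a * b * m * k.
have d_neq0 : d != 0.
  apply/eqP=> /(two_block_det_eq0 a0 ab m0 k0 bm1 bk1)[am bm bk].
  (* As [a * m], [b * m] and [b * k] are all 1, this vector has zero column sums and [b] times its
     mass is 0. *)
  have [ml mr cl' cr'] := glueP 1 (-1).
  have z : {in below t, forall i,
      (if i \in below (lc t) then 1 * mu i else -1 * ka i) = 0}.
    apply: off_spine_ker => // [j /in_t/orP[/cl'|/cr'] ->|].
    - by rewrite mulN1r mulrN bk subrr.
    - by rewrite mul1r am subrr.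
    - rewrite (sum_below_node _ nt) ml mr -/b mulrDr mul1r mulN1r mulrN.
      by rewrite bm bk subrr.
  have : m = 0.
    rewrite /m big1 // => i li.
    have := z i (below_prec (successors_prec lt) li).
    by rewrite li mul1r.
  by apply/eqP; rewrite gt_eqF.
have d0 : 0 < d by rewrite lt_def d_neq0; apply: two_block_det_ge0.
(* The solution by Cramer's rule of [p + b * (q * k) = 1] and [a * (p * m) + q = 1]. *)
pose p := (1 - b * k) / d; pose q := (1 - a * m) / d.
have p0 : 0 <= p by rewrite divr_ge0 ?(ltW d0) ?subr_ge0.
have q0 : 0 <= q by rewrite divr_ge0 ?(ltW d0) ?subr_ge0.
have [ml mr cl' cr'] := glueP p q.
exists (fun i => if i \in below (lc t) then p * mu i else q * ka i).
have massE : mass t (fun i => if i \in below (lc t) then p * mu i else q * ka i)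
    = p * m + q * k.
  by rewrite (sum_below_node _ nt) ml mr.
have mass1 (c : R) : 1 - c * (p * m + q * k) =
    ((1 - c * m) * (1 - c * k) - (c - a) * (c - b) * m * k) / d.
  by rewrite /p /q /d; field.
have pq (c : R) := @two_block_mass R a b m k ab m0 k0 bm1 bk1 d_neq0 c.
have p_eq0 : (p == 0) = (b * k == 1).
  by rewrite mulf_eq0 invr_eq0 (negPf d_neq0) orbF subr_eq0 eq_sym.
have q_eq0 : (q == 0) = (a * m == 1).
  by rewrite mulf_eq0 invr_eq0 (negPf d_neq0) orbF subr_eq0 eq_sym.
split; rewrite ?massE.
- move=> j /in_t/orP[/cl'|/cr'] ->; rewrite /p /q /d; field; exact: d_neq0.
- move=> y y0.
  (* On each child, the column sums of a kernel vector are constant, so it is a multiple of that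
     child's potential. The two masses then solve a homogeneous system of determinant [d]. *)
  have yl : {in below (lc t), forall i, y i = - (b * mass (rc t) y) * mu i}.
    move=> i li; apply/eqP; rewrite -subr_eq0 mulNr opprK; apply/eqP.
    pose z i := y i + b * mass (rc t) y * mu i.
    apply: (pot_ker pmu (y := z)) li => j lj.
    under eq_bigr => l _ do rewrite mulrDr.
    rewrite big_split /= sumZ (pot_eq pmu lj) mulr1 -colsum_lchild // y0 //.
    exact: below_prec (successors_prec lt) lj.
  have yr : {in below (rc t), forall i, y i = - (a * mass (lc t) y) * ka i}.
    move=> i ri; apply/eqP; rewrite -subr_eq0 mulNr opprK; apply/eqP.
    pose z i := y i + a * mass (lc t) y * ka i.
    apply: (pot_ker pka (y := z)) ri => j rj.
    under eq_bigr => l _ do rewrite mulrDr.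
    rewrite big_split /= sumZ (pot_eq pka rj) mulr1 addrC.
    rewrite -colsum_rchild // y0 //.
    exact: below_prec (successors_prec rt) rj.
  have sl : mass (lc t) y = - (b * mass (rc t) y) * m.
    by rewrite /m [RHS]mulr_sumr; apply: eq_bigr.
  have sr : mass (rc t) y = - (a * mass (lc t) y) * k.
    by rewrite /k [RHS]mulr_sumr; apply: eq_bigr.
  have sl0 : mass (lc t) y = 0.
    apply: (mulIf d_neq0); rewrite mul0r /d mulrBr mulr1 {1}sl sr; ring.
  have sr0 : mass (rc t) y = 0 by rewrite sr sl0 mulr0 oppr0 mul0r.
  move=> i /in_t/orP[/yl|/yr] ->; first by rewrite sr0 mulr0 oppr0 mul0r.
  by rewrite sl0 mulr0 oppr0 mul0r.
- move=> i /in_t; case: ifP => [li _|_ /= ri].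
    by rewrite mulr_ge0 // (pot_ge0 pmu li).
  by rewrite mulr_ge0 // (pot_ge0 pka ri).
(* [p] and [q] cannot both vanish: [b * k = 1] and [a * m = 1] would give [d = 0]. *)
- have [p_eq|p_neq] := eqVneq p 0; last first.
    have p_gt0 : 0 < p by rewrite lt_def p_neq.
    exact: ltr_pwDl (mulr_gt0 p_gt0 m0) (mulr_ge0 q0 (ltW k0)).
  rewrite p_eq mul0r add0r; apply: mulr_gt0 => //.
  rewrite lt_def q0 andbT q_eq0.
  apply: contra d_neq0 => /eqP am; move/eqP: p_eq; rewrite p_eq0 => /eqP bk.
  have -> : d = 1 - a * m * (b * k) by rewrite /d; ring.
  by rewrite bk am mulr1 subrr.
- move=> c cb; rewrite -subr_ge0 mass1 divr_ge0 ?(ltW d0) //.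
  by case: (pq c cb).
- move=> c cb; rewrite eq_sym -subr_eq0 mass1 mulf_eq0 invr_eq0.
  rewrite (negPf d_neq0) orbF.
  have [_ ->] := pq c cb.
  rewrite (pot_mass_eq pmu (cl _ cb)) (pot_mass_eq pka (cr _ cb)).
  apply/orP/exists_inP => [[]/exists_inP[i ti ai]|[i /in_t/orP[] ti ai]].
  + by exists i => //; apply: below_prec ti; apply: successors_prec.
  + by exists i => //; apply: below_prec ti; apply: successors_prec.
  + by left; apply/exists_inP; exists i.
  + by right; apply/exists_inP; exists i.
- move=> i /in_t; case: ifP => [li _|_ /= ri].
    (* The left edge is in [Gamma] iff some leaf of the right child has diagonal entry [b], that is
       [b * k = 1], that is [p = 0]. *)
    rewrite (geod_Gamma_successor lt); last by move: li; rewrite inE.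
    rewrite edge_lchild_Gamma // lchild_Gamma_off_spine //.
    rewrite -(pot_gt0 pmu li) -(pot_mass_eq pka (cr _ bb)) -/k.
    by rewrite -p_eq0; apply: mulr_ge0_gt0; rewrite // (pot_ge0 pmu li).
  rewrite (geod_Gamma_successor rt); last by move: ri; rewrite inE.
  rewrite edge_rchild_Gamma // rchild_Gamma_off_spine //.
  rewrite -(pot_gt0 pka ri) -(pot_mass_eq pmu (cl _ aa)) -/m.
  by rewrite -q_eq0; apply: mulr_ge0_gt0; rewrite // (pot_ge0 pka ri).
Qed.

Lemma off_spine_potential_exists t : ~~ spine t ->
  exists nu, off_spine_potential t nu.
Proof.
move: t; apply: (tree_ind (G := D)) => t IH off.
have [/(lab_leaf labD)[i ti]|nt] := boolP (leaf D t).
  by rewrite -ti in off *; apply: off_spine_potential_lab.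
have off_succ s : s \in successors D t -> ~~ spine s.
  by move=> /successors_prec st; apply: contra off; apply: spine_prec.
have lt := lchild_successor nt; have rt := rchild_successor nt.
have [mu pmu] := IH _ lt (off_succ _ lt).
have [ka pka] := IH _ rt (off_succ _ rt).
exact: off_spine_potential_node pmu pka.
Qed.

(** * Vertices on the spine *)

(** Any other leaf leaves the spine through a left edge, which is in [Gamma]; the last leaf is
    reached by right edges only, which are not. *)
Lemma geod_Gamma_spine L i : spine L -> i \in below L ->
  (geod_edges D (lab i) L :&: Gam == set0) = (i == ord_max).
Proof.
move: L; apply: (tree_ind (G := D)) => L IH sL Li.
have [leafL|nL] := boolP (leaf D L).
  have iL : lab i = L by apply: leaf_prec leafL _; move: Li; rewrite inE.
  have nL : lab ord_max = L by apply: leaf_prec leafL _; rewrite -spineE.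
  by rewrite iL geod_edges_self set0I eqxx -(inj_eq (lab_inj labD)) iL nL eqxx.
have lt := lchild_successor nL; have rt := rchild_successor nL.
have := Li; rewrite leaves_below_node // inE => /orP[li|ri].
  rewrite (geod_Gamma_successor lt); last by move: li; rewrite inE.
  rewrite edge_lchild_Gamma // /lchild_in_Gamma sL /=.
  apply/esym/negbTE; apply: contraNneq (lchild_off_spine nL sL) => i_max.
  by rewrite spine_below -i_max.
rewrite (geod_Gamma_successor rt); last by move: ri; rewrite inE.
rewrite edge_rchild_Gamma // /rchild_in_Gamma sL /=.
exact: IH rt (spine_rchild suppU nL sL) ri.
Qed.

Lemma exiting_roots_spine L i : spine L -> i \in below L ->
  (i \in exiting_roots U (below L)) = (i == ord_max).
Proof.
move=> sL Li; pose a := alpha (lab ord_max).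
have a0 : a != 0.
  (* If [a] were 0, the constant row of the last leaf would be a zero row of [U]. *)
  apply/eqP=> a0; have : U^T *m delta_mx ord_max (0 : 'I_1) = 0.
    apply/matrixP=> j l; rewrite !mxE big1 // => k _; rewrite !mxE.
    have [->|_] := eqVneq k ord_max; last by rewrite mulr0.
    by rewrite entry_last_row -/a a0 mul0r.
  have unitUT : U^T \in unitmx by rewrite unitmx_tr.
  move=> /(canRL (mulKmx unitUT)); rewrite mulmx0 => /matrixP/(_ ord_max 0).
  by rewrite !mxE !eqxx => /eqP; rewrite oner_eq0.
have a_gt0 : 0 < a by rewrite lt_def a0 (alpha_ge0 suppU).
rewrite (exiting_rootsE (nu := fun i => if i == ord_max then a^-1 else 0)) //.
- by case: eqP; rewrite ?ltxx ?invr_gt0.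
- move=> j Lj; rewrite (bigD1 ord_max) -?spine_below //= eqxx entry_last_row.
  rewrite divff // big1 ?addr0 // => k /andP[_ /negPf ->].
  by rewrite mulr0.
- by move=> y; apply: spine_ker.
Qed.

End UMatrixEntries.

Theorem theorem3p1 (R : realFieldType) (n : nat) (T : finType)
    (D : dyadic_tree T) (lab : 'I_n.+1 -> T) (alpha beta : T -> R)
    (U : 'M[R]_n.+1)
    (labD : leaf_labelling D lab) (suppU : supports D lab alpha beta U)
    (nonsingU : U \in unitmx) :
  exiting_roots U (leaves_below D lab (tree_root D)) = [set ord_max] /\
  (forall (L : T) (i : 'I_n.+1), i \in leaves_below D lab L ->
     (i \in exiting_roots U (leaves_below D lab L) <->
      geod_edges D (lab i) L :&: Gamma D lab alpha beta = set0)).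
Proof.
split=> [|L i Li].
  apply/setP=> i; rewrite in_set1.
  by rewrite (exiting_roots_spine labD suppU nonsingU) ?spineE ?inE ?prec_root.
rewrite (rwP eqP); have [sL|nsL] := boolP (on_spine D lab L).
  rewrite (exiting_roots_spine labD suppU nonsingU) //.
  by rewrite (geod_Gamma_spine labD suppU).
have [nu pnu] := off_spine_potential_exists labD suppU nonsingU nsL.
by rewrite (exiting_rootsE (pot_eq pnu) (pot_ker pnu)) // (pot_gt0 pnu).
Qed.
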